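(* (Parabolic comparison.) Assume $(\mathcal P)$. Let $u\in\mathcal C^{0,1}(\mathcal J^a_T)\cap\mathcal C^{1,2}_b(\overset{\circ}{\mathcal J^a_T})$ be a super solution and $v\in\mathcal C^{0,1}(\mathcal J^a_T)\cap\mathcal C^{1,2}_b(\overset{\circ}{\mathcal J^a_T})$ a sub solution of $$\begin{cases}\partial_tu_i(t,x)-\sigma_i(x,\partial_xu_i(t,x))\,\partial_x^2u_i(t,x)+H_i(x,u_i(t,x),\partial_xu_i(t,x))=0, & (t,x)\in(0,T)\times(0,a_i),\\ F(u(t,0),\partial_xu(t,0))=0, & t\in(0,T),\end{cases}$$ satisfying, for all $i\in\{1,\dots,I\}$, $u_i(t,a_i)\ge v_i(t,a_i)$ for all $t\in[0,T]$ and $u_i(0,x)\ge v_i(0,x)$ for all $x\in[0,a_i]$. Then $u_i(t,x)\ge v_i(t,x)$ for every $(t,(x,i))\in\mathcal J^a_T$.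
   Context: Fix $T>0$, an integer $I\ge1$ and $a=(a_1,\dots,a_I)\in(0,\infty)^I$. Junction. $\mathcal J^a=\bigcup_{i=1}^I J_i^{a_i}$ is the union of $I$ copies $J_i^{a_i}=[0,a_i]$ glued at the single common point $0$; points are written $(x,i)$ with $x\in[0,a_i]$. $\mathcal J^a_T=[0,T]\times\mathcal J^a$ and $\overset{\circ}{\mathcal J^a_T}=(0,T)\times\bigcup_i(0,a_i)$. A function $f$ on $\mathcal J^a_T$ is a family $(f_i)_{1\le i\le I}$ of functions on $[0,T]\times[0,a_i]$. $f\in\mathcal C^{0,1}(\mathcal J^a_T)$ means that $f_i$ and $\partial_xf_i$ are continuous on $[0,T]\times[0,a_i]$ for each $i$ and $f_i(t,0)=f_j(t,0)$ for all $i,j,t$. $f\in\mathcal C^{1,2}_b(\overset{\circ}{\mathcal J^a_T})$ means that on each $(0,T)\times(0,a_i)$ the functions $f_i,\partial_xf_i,\partial_x^2f_i,\partial_tf_i$ are continuous and bounded. Notation: $u(t,0)=(u_1(t,0),\dots,u_I(t,0))$, $\partial_xu(t,0)=(\partial_xu_1(t,0),\dots,\partial_xu_I(t,0))$. $g\in\mathcal C^1(\mathcal J^a)\cap\mathcal C^2_b(\overset{\circ}{\mathcal J^a})$ means $g_i\in\mathcal C^1([0,a_i])$, $g_i(0)=g_j(0)$, and $g_i\in\mathcal C^2((0,a_i))$ with bounded derivatives up to order $2$. Super/sub solutions. $u$ is a super solution (resp. sub solution) if for all $i$ and $(t,x)\in(0,T)\times(0,a_i)$, $\partial_tu_i-\sigma_i(x,\partial_xu_i)\partial_x^2u_i+H_i(x,u_i,\partial_xu_i)\ge0$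 (resp. $\le0$), and $F(u(t,0),\partial_xu(t,0))\le0$ (resp. $\ge0$) for all $t\in(0,T)$. Monotonicity on $\mathbb R^I$. $x\le y$ means $x_i\le y_i$ for all $i$; $x<y$ means $x\le y$ and $x_j<y_j$ for some $j$. $G:\mathbb R^I\to\mathbb R$ is nondecreasing if $x\le y\Rightarrow G(x)\le G(y)$, increasing if $x<y\Rightarrow G(x)<G(y)$; nonincreasing/decreasing means $-G$ is nondecreasing/increasing. Data. $F\in\mathcal C^0(\mathbb R^I\times\mathbb R^I,\mathbb R)$, $g\in\mathcal C^1(\mathcal J^a)\cap\mathcal C^2_b(\overset{\circ}{\mathcal J^a})$, and for each $i$: $\sigma_i\in\mathcal C^1([0,a_i]\times\mathbb R,\mathbb R)$, $H_i\in\mathcal C^1([0,a_i]\times\mathbb R^2,\mathbb R)$, $\phi_i\in\mathcal C^1([0,T],\mathbb R)$. Assumption $(\mathcal P)$: (i) Either $F$ is decreasing in its first ($\mathbb R^I$-)variable and nondecreasing in its second, or $F$ is nonincreasing in its first variable and increasing in its second; in both cases there is $(b,B)\in\mathbb R^I\times\mathbb R^I$ with $F(b,B)=0$. There is a real $m\ge2$ such that: (ii) there are constants $\underline\nu,\overline\nu>0$ with $\underline\nu(1+|p|)^{m-2}\le\sigma_i(x,p)\le\overline\nu(1+|p|)^{m-2}$ for all $i$, $(x,p)\in[0,a_i]\times\mathbb R$; (iii) there is an increasing continuous real function $\mu$ with $|H_i(x,u,p)|\le\mu(|u|)(1+|p|)^m$ for all $i$, $(x,u,p)\in[0,a_i]\times\mathbb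 R^2$; (iv) for all $i$ and $(x,u,p)\in[0,a_i]\times\mathbb R^2$: a) $|\partial_p\sigma_i(x,p)|(1+|p|)^2+|\partial_pH_i(x,u,p)|\le\gamma(|u|)(1+|p|)^{m-1}$; b) $|\partial_x\sigma_i(x,p)|(1+|p|)^2+|\partial_xH_i(x,u,p)|\le(\varepsilon(|u|)+P(|u|,|p|))(1+|p|)^{m+1}$; c) $-C_H\le\partial_uH_i(x,u,p)\le(\varepsilon(|u|)+P(|u|,|p|))(1+|p|)^m$; where $\gamma,\varepsilon$ are continuous nonnegative increasing functions, $P$ is continuous, increasing in its first variable, and $P(u,p)\to0$ as $p\to+\infty$ uniformly for $u$ in any $[0,u_1]$, and $C_H>0$; $\gamma,\varepsilon,P,C_H$ do not depend on $i$; (v) $F(g(0),\partial_xg(0))=0$ and $g_i(a_i)=\phi_i(0)$ for all $i$. *)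

(* Defs.v *)
From mathcomp Require Import all_boot all_order all_algebra.
From mathcomp Require Import all_classical all_reals all_analysis.

Set Implicit Arguments.
Unset Strict Implicit.
Unset Printing Implicit Defensive.

Import Order.TTheory GRing.Theory Num.Theory.
Import numFieldNormedType.Exports.

Local Open Scope classical_set_scope.
Local Open Scope ring_scope.

Section relative_derivative.
Context {R : realType}.
Implicit Types (A : set R) (f : R -> R) (x : R).

(* Same difference quotient as derive1, but restricted to increments h with
   h + x in A: a one-sided derivative at an endpoint of an interval A, the
   usual derivative at an interior point of A. *)
Definition derivable_in A f x : Prop :=
  cvg (h^-1 *: (f (h + x) - f x) @[h --> within [set h | A (h + x)] 0^']).

Definition derive_in A f x : R :=
  lim (h^-1 *: (f (h + x) - f x) @[h --> within [set h | A (h + x)] 0^']).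

Lemma within_interior A x : nbhs x A -> within [set h | A (h + x)] 0^' = 0^'.
Proof.
move=> xA; have A0 : \forall h \near (0 : R), A (h + x).
  have : shift x h @[h --> 0] --> x.
    by rewrite -[X in _ --> X]add0r; apply: cvgD; [exact: cvg_id|exact: cvg_cst].
  by move=> /(_ _ xA).
apply/seteqP; split => B; rewrite /within /dnbhs /= /within /= => HB.
- by apply: filterS2 A0 HB => h Ahx HBh h0; exact: HBh.
- by apply: filterS HB => h HBh h0 _; exact: HBh.
Qed.

Lemma derive_in_interior A f x : nbhs x A -> derive_in A f x = derive1 f x.
Proof. by move=> Ax; rewrite /derive_in within_interior. Qed.

Lemma derivable_in_interior A f x : nbhs x A ->
  derivable_in A f x <-> derivable f x 1.
Proof.
move=> Ax; rewrite /derivable_in within_interior// /derivable.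
suff -> : (fun h : R => h^-1 *: (f (h + x) - f x)) =
  (fun h : R => h^-1 *: ((f \o shift x) (h *: 1) - f x)) by [].
by apply/funext => h /=; rewrite [h *: 1]mulr1.
Qed.

End relative_derivative.

Section function_classes.
Context {R : realType}.

Definition C1_itv (c d : R) (f : R -> R) : Prop :=
  (forall x : R, x \in `[c, d] -> derivable_in `[c, d] f x) /\
  {within `[c, d], continuous (derive_in `[c, d] f)}.

(* C^1 on [0, l] x R, for a function of (x, p) *)
Definition C1_itv_line (l : R) (s : R -> R -> R) : Prop :=
  let D : set (R * R) := `[0, l] `*` [set: R] in
  [/\ forall x p : R, x \in `[0, l] ->
        derivable_in `[0, l] (s ^~ p) x /\ derivable (s x) p 1,
      {within D, continuous (fun z : R * R => s z.1 z.2)},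
      {within D, continuous (fun z : R * R => derive_in `[0, l] (s ^~ z.2) z.1)} &
      {within D, continuous (fun z : R * R => derive1 (s z.1) z.2)}].

(* C^1 on [0, l] x R^2, for a function of (x, u, p) *)
Definition C1_itv_plane (l : R) (H : R -> R -> R -> R) : Prop :=
  let D : set (R * (R * R)) := `[0, l] `*` [set: R * R] in
  [/\ forall x u p : R, x \in `[0, l] ->
        [/\ derivable_in `[0, l] (fun y => H y u p) x,
            derivable (fun w => H x w p) u 1 &
            derivable (H x u) p 1],
      {within D, continuous (fun z : R * (R * R) => H z.1 z.2.1 z.2.2)},
      {within D, continuous
        (fun z : R * (R * R) => derive_in `[0, l] (fun y => H y z.2.1 z.2.2) z.1)},
      {within D, continuous (fun z : R * (R * R) => derive1 (fun w => H z.1 w z.2.2) z.2.1)} &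
      {within D, continuous (fun z : R * (R * R) => derive1 (H z.1 z.2.1) z.2.2)}].

End function_classes.

(* Functions on the junction are families of functions of x, and functions on
   [0, T] x junction are families of functions of (t, x); the values outside
   [0, a i], resp. [0, T] x [0, a i], are irrelevant. *)
Section junction.
Context {R : realType} {n : nat}.
Variables (T : R) (a : 'I_n -> R).
Implicit Types (g : 'I_n -> R -> R) (u : 'I_n -> R -> R -> R).

Definition dx u (i : 'I_n) (t x : R) : R := derive_in `[0, a i] (u i t) x.
Definition dxx u (i : 'I_n) (t x : R) : R := derive1 (dx u i t) x.
Definition dt u (i : 'I_n) (t x : R) : R := derive1 (u i ^~ x) t.

Definition vertex_value u (t : R) : 'rV[R]_n := \row_i u i t 0.
Definition vertex_dx u (t : R) : 'rV[R]_n := \row_i dx u i t 0.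

Definition C01_junction u : Prop :=
  [/\ forall i (t x : R), t \in `[0, T] -> x \in `[0, a i] ->
        derivable_in `[0, a i] (u i t) x,
      forall i, {within `[0, T] `*` `[0, a i],
        continuous (fun z : R * R => u i z.1 z.2)},
      forall i, {within `[0, T] `*` `[0, a i],
        continuous (fun z : R * R => dx u i z.1 z.2)} &
      forall i j (t : R), t \in `[0, T] -> u i t 0 = u j t 0].

Definition continuous_bounded (D : set (R * R)) (f : R -> R -> R) : Prop :=
  {within D, continuous (fun z : R * R => f z.1 z.2)} /\
  [bounded f z.1 z.2 | z in D].

Definition C12b_junction u : Prop := forall i,
  let Q : set (R * R) := (`]0, T[ `*` `]0, a i[) in
  [/\ forall t x : R, t \in `]0, T[ -> x \in `]0, a i[ ->
        [/\ derivable_in `[0, a i] (u i t) x,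
            derivable (dx u i t) x 1 & derivable (u i ^~ x) t 1],
      continuous_bounded Q (u i),
      continuous_bounded Q (dx u i),
      continuous_bounded Q (dxx u i) &
      continuous_bounded Q (dt u i)].

Definition C1_C2b_junction g : Prop :=
  [/\ forall i, C1_itv 0 (a i) (g i),
      forall i j, g i 0 = g j 0 &
      forall i, let g' := derive_in `[0, a i] (g i) in
        [/\ forall x : R, x \in `]0, a i[ -> derivable g' x 1,
            {within `]0, a i[, continuous (derive1 g')},
            [bounded g i x | x in `]0, a i[ ],
            [bounded g' x | x in `]0, a i[ ] &
            [bounded derive1 g' x | x in `]0, a i[ ]]].

Variables (sigma : 'I_n -> R -> R -> R) (H : 'I_n -> R -> R -> R -> R).
Variable F : 'rV[R]_n * 'rV[R]_n -> R.

Definition parabolic_op u (i : 'I_n) (t x : R) : R :=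
  dt u i t x - sigma i x (dx u i t x) * dxx u i t x
    + H i x (u i t x) (dx u i t x).

Definition super_solution u : Prop :=
  (forall i (t x : R), t \in `]0, T[ -> x \in `]0, a i[ ->
     0 <= parabolic_op u i t x) /\
  (forall t : R, t \in `]0, T[ -> F (vertex_value u t, vertex_dx u t) <= 0).

Definition sub_solution u : Prop :=
  (forall i (t x : R), t \in `]0, T[ -> x \in `]0, a i[ ->
     parabolic_op u i t x <= 0) /\
  (forall t : R, t \in `]0, T[ -> 0 <= F (vertex_value u t, vertex_dx u t)).

End junction.

Section monotonicity.
Context {R : realType} {n : nat}.
Implicit Types (x y : 'rV[R]_n) (G : 'rV[R]_n -> R).

Definition vle x y : Prop := forall i, x 0 i <= y 0 i.
Definition vlt x y : Prop := vle x y /\ exists j, x 0 j < y 0 j.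

Definition vnondecreasing G : Prop := forall x y, vle x y -> G x <= G y.
Definition vincreasing G : Prop := forall x y, vlt x y -> G x < G y.
Definition vnonincreasing G : Prop := vnondecreasing (fun x => - G x).
Definition vdecreasing G : Prop := vincreasing (fun x => - G x).

End monotonicity.

Section assumption_P.
Context {R : realType} {n : nat}.
Variables (a : 'I_n -> R) (sigma : 'I_n -> R -> R -> R).
Variables (H : 'I_n -> R -> R -> R -> R) (F : 'rV[R]_n * 'rV[R]_n -> R).
Variables (g : 'I_n -> R -> R) (phi : 'I_n -> R -> R).

(* The growth functions only ever take arguments |u|, |p|, hence live on
   [0, +oo[. *)
Definition continuous_increasing (f : R -> R) : Prop :=
  {within `[0, +oo[, continuous f} /\
  {in `[0, +oo[ &, {homo f : x y / x < y}}.

Definition continuous_nonneg_increasing (f : R -> R) : Prop :=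
  continuous_increasing f /\ forall x : R, 0 <= x -> 0 <= f x.

Definition vanishing_modulus (P : R -> R -> R) : Prop :=
  [/\ {within `[0, +oo[ `*` `[0, +oo[, continuous (fun z : R * R => P z.1 z.2)},
      forall p : R, 0 <= p -> {in `[0, +oo[ &, {homo P ^~ p : x y / x < y}} &
      forall u1 : R, 0 <= u1 ->
        {uniform `[0, u1], (fun u => P u p) @[p --> +oo] --> cst 0}].

Definition P_vertex : Prop :=
  ((forall y, vdecreasing (fun x => F (x, y))) /\
   (forall x, vnondecreasing (fun y => F (x, y))) \/
   (forall y, vnonincreasing (fun x => F (x, y))) /\
   (forall x, vincreasing (fun y => F (x, y)))) /\
  (exists b B, F (b, B) = 0).

Definition P_ellipticity (m : R) : Prop :=
  exists nu1 nu2 : R, [/\ 0 < nu1, 0 < nu2 &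
    forall i (x p : R), x \in `[0, a i] ->
      nu1 * (1 + `|p|) `^ (m - 2) <= sigma i x p
        <= nu2 * (1 + `|p|) `^ (m - 2)].

Definition P_growth (m : R) : Prop :=
  exists2 mu : R -> R, continuous_increasing mu &
    forall i (x u p : R), x \in `[0, a i] ->
      `|H i x u p| <= mu `|u| * (1 + `|p|) `^ m.

Definition P_derivatives (m : R) : Prop :=
  exists (gamma eps : R -> R) (P : R -> R -> R) (CH : R),
  [/\ continuous_nonneg_increasing gamma, continuous_nonneg_increasing eps,
      vanishing_modulus P, 0 < CH &
      forall i (x u p : R), x \in `[0, a i] ->
      let dp_sigma := derive1 (sigma i x) p in
      let dx_sigma := derive_in `[0, a i] (sigma i ^~ p) x in
      let dp_H := derive1 (H i x u) p in
      let dx_H := derive_in `[0, a i] (fun y => H i y u p) x in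
      let du_H := derive1 (fun w => H i x w p) u in
      [/\ `|dp_sigma| * (1 + `|p|) ^+ 2 + `|dp_H|
            <= gamma `|u| * (1 + `|p|) `^ (m - 1),
          `|dx_sigma| * (1 + `|p|) ^+ 2 + `|dx_H|
            <= (eps `|u| + P `|u| `|p|) * (1 + `|p|) `^ (m + 1) &
          - CH <= du_H <= (eps `|u| + P `|u| `|p|) * (1 + `|p|) `^ m]].

Definition P_compatibility : Prop :=
  F (\row_i g i 0, \row_i derive_in `[0, a i] (g i) 0) = 0 /\
  forall i, g i (a i) = phi i 0.

Definition assumption_P : Prop :=
  [/\ P_vertex,
      exists2 m : R, 2 <= m &
        [/\ P_ellipticity m, P_growth m & P_derivatives m] &
      P_compatibility].

End assumption_P.

(* Main.v *)
(* Suppose [v - u > 0] somewhere; by continuity this happens at some time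
   [s < T].  Maximise [exp (- lam t) (v_i - u_i)(t, x) + delta x] over [0, s] and
   the junction, with [lam = C_H + 1] and [delta > 0] small.  The tilt [delta x]
   makes the comparison of slopes at the vertex strict: a maximum at [x = 0]
   gives [v > u] and [dx v < dx u] on every edge, which contradicts the vertex
   condition under either alternative for [F], so no Hopf lemma is needed.  At an
   interior maximum [dx v = dx u - d] with [d = delta exp (lam t)]; as [dxx u] is
   bounded and [sigma], [H] are Lipschitz in [p] on bounded sets, the equation
   gives [v - u <= const * d], which fails for small [delta]. *)
Require Import Defs.
From mathcomp Require Import all_boot all_order all_algebra.
From mathcomp Require Import all_classical all_reals all_analysis.
From mathcomp Require Import ring lra.
Import Order.TTheory GRing.Theory Num.Theory.
Import numFieldNormedType.Exports.
Local Open Scope classical_set_scope.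
Local Open Scope ring_scope.

(** * One-variable calculus at a maximum *)

Lemma MVT_derive1 (R : realType) (f : R -> R) (a b : R) : a < b ->
  (forall x, a <= x <= b -> derivable f x 1) ->
  exists2 c, a < c < b & f b - f a = derive1 f c * (b - a).
Proof.
move=> ab df.
have [x||c] := MVT (f := f) (df := derive1 f) ab; last by rewrite in_itv; exists c.
  rewrite in_itv /= => /andP[/ltW ax /ltW xb].
  by rewrite derive1E; apply/derivableP/df/andP.
by apply: derivable_within_continuous => x; rewrite in_itv; exact: df.
Qed.

(** A limit survives passing to a finer filter. Taking [G] to be [0^'+] gives right derivatives at
    the vertex, and [0^'] gives ordinary derivatives. *)
Lemma derive_in_cvg (R : realType) (A : set R) (f : R -> R) (x : R)
    (G : set_system R) :
  derivable_in A f x -> G `=>` within [set h | A (h + x)] 0^' ->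
  h^-1 * (f (h + x) - f x) @[h --> G] --> derive_in A f x.
Proof. by move=> /[swap] GA; apply: cvg_trans; exact: cvg_app. Qed.

Lemma derive1_cvg (R : realType) (f : R -> R) (x : R) : derivable f x 1 ->
  h^-1 * (f (h + x) - f x) @[h --> 0^'] --> derive1 f x.
Proof.
have AT : nbhs x [set: R] by exact: filterT.
move=> /(derivable_in_interior f AT) df; rewrite -(derive_in_interior f AT).
apply: (derive_in_cvg _ setT f x 0^' df) => B WB.
by move: WB; rewrite /within /=; apply: filterS => h Bh; exact: Bh.
Qed.

(** All left difference quotients are nonnegative. Only earlier times are compared because a maximum
    over [[0, s]] may be attained at the final time [s]. *)
Lemma derive1_ge0_left_max (R : realType) (f : R -> R) (c t : R) : c < t ->
  derivable f t 1 -> (forall s, c < s < t -> f s <= f t) -> 0 <= derive1 f t.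
Proof.
move=> ct /derive1_cvg/cvg_dnbhs_at_left df fmax.
apply: (cvgr_to_ge df); near=> h.
have h0 : h < 0 by near: h; exact: nbhs_left_lt.
have ch : c < h + t by rewrite -ltrBlDr; near: h; apply: nbhs_left_gt; lra.
rewrite nmulr_rge0 ?invr_lt0// subr_le0; apply: fmax; lra.
Unshelve. all: by end_near. Qed.

(** The right difference quotients of [g - f] at 0 are at least [d], and so is their limit. This is
    where the tilt separates the two slopes at the vertex. *)
Lemma derive_in_le_left_end (R : realType) (f g : R -> R) (a d : R) : 0 < a ->
  derivable_in `[0, a] f 0 -> derivable_in `[0, a] g 0 ->
  (forall x, 0 <= x <= a -> f x - g x + d * x <= f 0 - g 0) ->
  derive_in `[0, a] f 0 + d <= derive_in `[0, a] g 0.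
Proof.
move=> a0 df dg fg; have GA : 0^'+ `=>` within [set h | `[0, a]%classic (h + 0)] 0^'.
  move=> B [r /= r0 rB]; near=> h.
  have h0 : 0 < h by near: h; exact: nbhs_right_gt.
  have ha : h < a by near: h; exact: nbhs_right_lt.
  apply: rB => /=.
  - by rewrite sub0r normrN gtr0_norm//; near: h; exact: nbhs_right_lt.
  - by rewrite gt_eqF.
  - by rewrite addr0 in_itv /= !ltW.
rewrite addrC -lerBrDr.
apply: (cvgr_to_ge (cvgB (derive_in_cvg _ _ _ _ _ dg GA)
  (derive_in_cvg _ _ _ _ _ df GA))).
near=> h.
have h0 : 0 < h by near: h; exact: nbhs_right_gt.
have ha : h < a by near: h; exact: nbhs_right_lt.
have hfg : f h - g h + d * h <= f 0 - g 0 by apply: fg; rewrite !ltW.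
change (d <= h^-1 * (g (h + 0) - g 0) - h^-1 * (f (h + 0) - f 0)).
rewrite -mulrBr ler_pdivlMl// !addr0; lra.
Unshelve. all: by end_near. Qed.

(** If the second derivative were positive, [f1], which vanishes at [x], would be positive just to
    the right of [x], and the mean value theorem would give a larger value of [f] there. The
    derivative is passed as [f1] so that the relative derivative [dx], tied to the usual one inside
    the edge, can be supplied. *)
Lemma interior_max_derivatives (R : realType) (f f1 : R -> R) (c d x : R) :
  c < x < d -> (forall y, c < y < d -> is_derive y 1 f (f1 y)) ->
  derivable f1 x 1 -> (forall y, c < y < d -> f y <= f x) ->
  f1 x = 0 /\ derive1 f1 x <= 0.
Proof.
move=> /andP[cx xd] df df1 fmax.
have f1x : f1 x = 0.
  have xcd : x \in `]c, d[ by rewrite in_itv /= cx xd.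
  have dfx : is_derive x 1 f (f1 x) by apply: df; rewrite cx xd.
  suff E : is_derive x 1 f 0.
    by rewrite -(@derive_val _ _ _ _ _ _ _ dfx) (@derive_val _ _ _ _ _ _ _ E).
  apply: (derive1_at_max _ _ xcd) => [|y|y]; rewrite ?in_itv /=; last exact: fmax.
    exact: le_trans (ltW cx) (ltW xd).
  by move=> /df/@ex_derive.
split=> //; rewrite leNgt; apply/negP => f2.
have := cvg_dnbhs_at_right (derive1_cvg _ _ _ df1) => /cvgr_gt/(_ _ f2) pos.
have [r /= r0 rP] : exists2 r : R, 0 < r & forall h, 0 < h < r -> 0 < f1 (h + x).
  case: pos => r /= r0 rP; exists r => // h /andP[h0 hr].
  have := rP h; rewrite /= sub0r normrN gtr0_norm// f1x subr0 => /(_ hr h0).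
  by rewrite pmulr_rgt0// invr_gt0.
pose y := x + Num.min (r / 2) ((d - x) / 2).
have xy : x < y by rewrite ltrDl lt_min; apply/andP; split; lra.
have yd : y < d by rewrite -ltrBrDl gt_min; apply/orP; right; lra.
have yr : y < x + r by rewrite ltrD2l gt_min; apply/orP; left; lra.
have df' z : x <= z <= y -> is_derive z 1 f (f1 z) by move=> zxy; apply: df; lra.
have [z zxy E] : exists2 z, x < z < y & f y - f x = f1 z * (y - x).
  have [z zxy|z zxy ->] := MVT_derive1 _ f _ _ xy.
    exact: (@ex_derive _ _ _ _ _ _ _ (df' _ zxy)).
  exists z => //; rewrite derive1E.
  suff /@derive_val-> : is_derive z 1 f (f1 z) by [].
  by apply: df'; lra.
have : 0 < f y - f x.
  rewrite E mulr_gt0 ?subr_gt0//.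
  have := rP (z - x); rewrite subrK; apply; lra.
by rewrite subr_gt0 ltNge fmax//; lra.
Qed.

(** * Maximum over time and the whole junction *)

(** Compactness gives a maximum on each edge, and the best of these finitely many is taken; [i] only
    witnesses that there is an edge. *)
Lemma continuous_family_max (R : realType) (n : nat) (s : R) (a : 'I_n -> R)
    (z : 'I_n -> R -> R -> R) (i : 'I_n) : 0 <= s -> (forall i, 0 <= a i) ->
  (forall i, {within `[0, s] `*` `[0, a i],
    continuous (fun y : R * R => z i y.1 y.2)}) ->
  exists j t0 x0, [/\ 0 <= t0 <= s, 0 <= x0 <= a j &
    forall k t x, 0 <= t <= s -> 0 <= x <= a k -> z k t x <= z j t0 x0].
Proof.
move=> s0 a0 zc.
have emax k : exists y : R * R, [/\ 0 <= y.1 <= s, 0 <= y.2 <= a k &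
    forall t x, 0 <= t <= s -> 0 <= x <= a k -> z k t x <= z k y.1 y.2].
  have ne : `[0, s] `*` `[0, a k] !=set0.
    by exists (0, 0); split => /=; rewrite in_itv /= lexx ?s0 ?a0.
  have cpt : compact (`[0, s] `*` `[0, a k]).
    by apply: compact_setX; exact: segment_compact.
  have [y /set_mem[/= y1 y2] ymax] := compact_EVT_max ne cpt (zc k).
  exists y; split; [by move: y1; rewrite in_itv|by move: y2; rewrite in_itv|].
  by move=> t x ts xa; apply: (ymax (t, x)); apply/mem_set; split; rewrite /= in_itv.
pose y k := sval (cid (emax k)).
have yP k : [/\ 0 <= (y k).1 <= s, 0 <= (y k).2 <= a k &
    forall t x, 0 <= t <= s -> 0 <= x <= a k -> z k t x <= z k (y k).1 (y k).2].
  exact: svalP (cid (emax k)).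
have [j _ jmax] := @Order.TotalTheory.arg_maxP _ R _ i xpredT
  (fun k => z k (y k).1 (y k).2) isT.
exists j, (y j).1, (y j).2; have [? ? _] := yP j; split=> // k t x ts xa.
by have [_ _ /(_ t x ts xa)/le_trans] := yP k; apply; exact: jmax.
Qed.

(** * Monotonicity and increment bounds drawn from the structural assumptions *)

(** Both arguments are changed strictly, so either alternative for [F] yields one strict and one
    weak inequality. A coordinate exists because [1 <= n], which makes the orders on vectors
    strict. *)
Lemma P_vertex_lt (R : realType) (n : nat) (F : 'rV[R]_n * 'rV[R]_n -> R)
    (x y p q : 'rV[R]_n) : (1 <= n)%N -> P_vertex F ->
  (forall i, x 0 i < y 0 i) -> (forall i, q 0 i < p 0 i) ->
  F (y, q) < F (x, p).
Proof.
case: n F x y p q => // n F x y p q _ [FP _] xy qp.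
have xyle : vle x y by move=> i; exact: ltW.
have qple : vle q p by move=> i; exact: ltW.
have xylt : vlt x y by split=> //; exists ord0.
have qplt : vlt q p by split=> //; exists ord0.
case: FP => -[F1 F2].
  by apply: lt_le_trans (F2 x _ _ qple); rewrite -ltrN2; exact: F1 q _ _ xylt.
by apply: le_lt_trans (F2 x _ _ qplt); rewrite -lerN2; exact: F1 q _ _ xyle.
Qed.

(** The mean value theorem turns the derivative bounds into increments. [C] is the constant [C_H],
    fixed before [K], whereas the Lipschitz constant in the slope depends on [K]. *)
Lemma P_derivatives_increments (R : realType) (n : nat) (a : 'I_n -> R)
    (sigma : 'I_n -> R -> R -> R) (H : 'I_n -> R -> R -> R -> R) (m : R) :
  2 <= m -> (forall i, C1_itv_line (a i) (sigma i)) ->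
  (forall i, C1_itv_plane (a i) (H i)) -> P_derivatives a sigma H m ->
  exists2 C : R, 0 < C & forall K : R, 0 <= K -> exists2 L : R, 0 <= L &
    forall i (x : R), 0 <= x <= a i ->
    forall p q : R, q < p -> `|p| <= K -> `|q| <= K ->
    [/\ `|sigma i x p - sigma i x q| <= L * (p - q),
        forall w : R, `|w| <= K -> `|H i x w p - H i x w q| <= L * (p - q) &
        forall w w' : R, w < w' -> - C * (w' - w) <= H i x w' q - H i x w q].
Proof.
move=> m2 sC1 HC1 [gam [eps [P [C [[[_ gam_inc] gam_ge0] _ _ C0 PD]]]]].
exists C => // K K0; exists (gam K * (1 + K) `^ (m - 1)).
  by rewrite mulr_ge0 ?powR_ge0 ?gam_ge0.
move=> i x xa p q qp pK qK.
have xi : x \in `[0, a i] by rewrite in_itv.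
(* The intermediate slope [r] lies between [q] and [p], hence in [[-K, K]], and the growth bound is
   monotone in both of its arguments. *)
have bnd (w r : R) : `|w| <= K -> q < r < p ->
    gam `|w| * (1 + `|r|) `^ (m - 1) <= gam K * (1 + K) `^ (m - 1).
  move=> wK /andP[qr rp]; apply: ler_pM; rewrite ?powR_ge0 ?gam_ge0//.
    move: wK; rewrite le_eqVlt => /predU1P[->//|wK].
    by apply/ltW/gam_inc; rewrite ?in_itv/= ?andbT.
  have rK : `|r| <= K.
    move: pK qK; rewrite !ler_norml => /andP[_ pK] /andP[Kq _].
    by apply/andP; split; lra.
  apply: ge0_ler_powR; rewrite ?nnegrE; [lra|by rewrite addr_ge0|lra|].
  by rewrite lerD2l.
split=> [|w wK|w w' ww'].
- have [|r qrp ->] := MVT_derive1 _ (sigma i x) _ _ qp.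
    by move=> r _; have [/(_ x r xi)[]] := sC1 i.
  have := bnd 0 r; rewrite normr0 => /(_ K0 qrp).
  have [] := PD i x 0 r xi; rewrite normr0 => + _ _ => dps bndr.
  rewrite normrM (gtr0_norm (_ : 0 < p - q)) ?subr_gt0// ler_pM2r ?subr_gt0//.
  apply: le_trans bndr; apply: le_trans dps.
  rewrite -[leLHS]addr0 lerD// ler_peMr// expr2.
  by have r0 := normr_ge0 r; rewrite -[leLHS]mulr1 ler_pM//; lra.
- have [|r qrp ->] := MVT_derive1 _ (H i x w) _ _ qp.
    by move=> r _; have [/(_ x w r xi)[]] := HC1 i.
  have [dpH _ _] := PD i x w r xi.
  rewrite normrM (gtr0_norm (_ : 0 < p - q)) ?subr_gt0// ler_pM2r ?subr_gt0//.
  apply: le_trans (bnd w r wK qrp); apply: le_trans dpH.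
  by rewrite lerDr mulr_ge0// exprn_ge0// addr_ge0.
- have [|r _ ->] := MVT_derive1 _ (fun y => H i x y q) _ _ ww'.
    by move=> r _; have [/(_ x r q xi)[]] := HC1 i.
  have [_ _ /andP[duH _]] := PD i x r q xi.
  by rewrite ler_pM2r ?subr_gt0.
Qed.

(** * Solutions in the open edges, and their behaviour in time *)

Lemma is_derive_dx (R : realType) (T : R) (n : nat) (a : 'I_n -> R)
    (u : 'I_n -> R -> R -> R) i (t x : R) :
  C12b_junction T a u -> 0 < t < T -> 0 < x < a i ->
  is_derive x 1 (u i t) (dx a u i t x).
Proof.
move=> uC tT xa; have [/(_ t x)] := uC i; rewrite !in_itv /= tT xa.
move=> /(_ isT isT)[du _ _] _ _ _ _.
have xi : nbhs x `[0, a i]%classic.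
  by apply: filterS (near_in_itvoo (a := 0) (b := a i) (x := x) _) => [y|];
    rewrite ?in_itv //=; move=> /andP[y0 ya]; rewrite in_itv /= !ltW.
rewrite /dx (derive_in_interior (u i t) xi) derive1E; apply/derivableP.
exact: (derivable_in_interior (u i t) xi).1 du.
Qed.

(** Each bound holds for all large [K]; finitely many edges and functions then share one such
    [K]. *)
Lemma C12b_uniform_bound (R : realType) (T : R) (n : nat) (a : 'I_n -> R)
    (u v : 'I_n -> R -> R -> R) :
  C12b_junction T a u -> C12b_junction T a v ->
  exists2 K : R, 0 <= K & forall i (t x : R), 0 < t < T -> 0 < x < a i ->
    [/\ `|u i t x| <= K, `|dx a u i t x| <= K,
        `|dxx a u i t x| <= K & `|dx a v i t x| <= K].
Proof.
move=> uC vC.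
suff : \forall K \near +oo, forall i (t x : R), 0 < t < T -> 0 < x < a i ->
    [/\ `|u i t x| <= K, `|dx a u i t x| <= K,
        `|dxx a u i t x| <= K & `|dx a v i t x| <= K].
  move=> /(filterI (nbhs_pinfty_ge (num_real 0))) /= /filter_ex[K [K0 KP]].
  by exists K.
apply: filter_forall => i.
have [_ [_ b1] [_ b2] [_ b3] _] := uC i; have [_ _ [_ b4] _ _] := vC i.
have bnd (f : R -> R -> R) :
    [bounded f z.1 z.2 | z in `]0, T[%classic `*` `]0, a i[%classic] ->
    \forall K \near +oo, forall t x, 0 < t < T -> 0 < x < a i -> `|f t x| <= K.
  rewrite /bounded_near; apply: filterS => K fK t x tT xa.
  by apply: (fK (t, x)); split; rewrite /= in_itv.
near=> K => t x tT xa; split; move: tT xa.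
- by move: t x; near: K; exact: bnd b1.
- by move: t x; near: K; exact: bnd b2.
- by move: t x; near: K; exact: bnd b3.
- by move: t x; near: K; exact: bnd b4.
Unshelve. all: by end_near. Qed.

(* [Hm] stands for [H] at the value of [u] and the slope of [v]. *)
Lemma interior_max_bound (R : realType)
    (vt ut vxx uxx sv su Hv Hu Hm w lam C K L d : R) :
  0 <= sv -> 0 <= L -> 0 <= d ->
  vt - sv * vxx + Hv <= 0 -> 0 <= ut - su * uxx + Hu -> lam * w <= vt - ut ->
  vxx <= uxx -> `|uxx| <= K -> `|su - sv| <= L * d ->
  - C * w <= Hv - Hm -> `|Hu - Hm| <= L * d ->
  (lam - C) * w <= L * (K + 1) * d.
Proof.
move=> sv0 L0 d0 hv hu hw vu uK suv Hvm; rewrite ler_norml => /andP[_ Hum].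
have K0 : 0 <= K by exact: le_trans uK.
have h1 : 0 <= sv * (uxx - vxx) by rewrite mulr_ge0// subr_ge0.
have h2 : `|(su - sv) * uxx| <= L * d * K by rewrite normrM ler_pM.
move: h2; rewrite ler_norml => /andP[h2 _].
lra.
Qed.

(** The derivative of the discounted function is [expR (- lam * t)] times [derive1 f t - lam * f t],
    and it is nonnegative at a left maximum. *)
Lemma discounted_left_max_derive1 (R : realType) (f : R -> R) (lam c t : R) :
  c < t -> derivable f t 1 ->
  (forall s, c < s < t -> expR (- lam * s) * f s <= expR (- lam * t) * f t) ->
  lam * f t <= derive1 f t.
Proof.
move=> ct df fmax.
have E : is_derive t 1 (fun s => expR (- lam * s) * f s)
    (expR (- lam * t) * (derive1 f t - lam * f t)).
  have dft : is_derive t 1 f (derive1 f t) by rewrite derive1E; exact/derivableP.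
  have := is_deriveM (is_derive1_comp (is_derive_expR (- lam * t))
    (is_deriveZ (- lam) (is_derive_id t 1))) dft.
  move=> /is_derive_eq; apply.
  by rewrite /GRing.scale /=; ring.
have := derive1_ge0_left_max _ _ _ _ ct (@ex_derive _ _ _ _ _ _ _ E) fmax.
by rewrite derive1E (@derive_val _ _ _ _ _ _ _ E) pmulr_rge0 ?expR_gt0// subr_ge0.
Qed.

(** Positivity persists on a neighbourhood of [(T, x)]. Moving back from [T] matters because the
    equations hold only at times strictly before [T]. *)
Lemma gt0_before_end (R : realType) (T l x : R) (f : R * R -> R) : 0 < T ->
  {within `[0, T] `*` `[0, l], continuous f} -> 0 <= x <= l -> 0 < f (T, x) ->
  exists2 s, 0 <= s < T & 0 < f (s, x).
Proof.
move=> T0 /subspace_continuousP fc xl f0.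
have Tx : (`[0, T] `*` `[0, l])%classic (T, x).
  by split; rewrite /= in_itv//= lexx ltW.
have [[B1 B2] /= [TB1 xB2] B_gt0] := cvgr_gt _ (fc _ Tx) _ f0.
near T^'- => s; exists s.
  apply/andP; split; [apply/ltW|]; near: s.
    exact: nbhs_left_gt.
  exact: nbhs_left_lt.
apply: (B_gt0 (s, x)); split => /=; rewrite ?in_itv//=.
- by near: s; exact: cvg_within.
- exact: nbhs_singleton.
- apply/andP; split; apply/ltW; near: s.
    exact: nbhs_left_gt.
  exact: nbhs_left_lt.
Unshelve. all: by end_near. Qed.

(** * Contradiction at a maximum of the discounted and tilted difference *)

Theorem theorem2p4 (R : realType) (T : R) (n : nat) (a : 'I_n -> R)
  (F : 'rV[R]_n * 'rV[R]_n -> R) (g : 'I_n -> R -> R)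
  (sigma : 'I_n -> R -> R -> R) (H : 'I_n -> R -> R -> R -> R)
  (phi : 'I_n -> R -> R) (u v : 'I_n -> R -> R -> R)
  (T_gt0 : 0 < T) (n_ge1 : (1 <= n)%N) (a_gt0 : forall i, 0 < a i)
  (F_cont : continuous F) (g_reg : C1_C2b_junction a g)
  (sigma_C1 : forall i, C1_itv_line (a i) (sigma i))
  (H_C1 : forall i, C1_itv_plane (a i) (H i))
  (phi_C1 : forall i, C1_itv 0 T (phi i))
  (HP : assumption_P a sigma H F g phi)
  (u_C01 : C01_junction T a u) (u_C12b : C12b_junction T a u)
  (v_C01 : C01_junction T a v) (v_C12b : C12b_junction T a v)
  (u_super : super_solution T a sigma H F u)
  (v_sub : sub_solution T a sigma H F v)
  (uv_bdry : forall i (t : R), t \in `[0, T] -> v i t (a i) <= u i t (a i))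
  (uv_init : forall i (x : R), x \in `[0, a i] -> v i 0 x <= u i 0 x) :
  forall i (t x : R), t \in `[0, T] -> x \in `[0, a i] -> v i t x <= u i t x.
Proof.
move=> i t x; rewrite !in_itv /= => /andP[t0 tT] xi.
have [FP [m m2 [[nu1 [nu2 [nu1_gt0 _ sigma_bnd]]] _ PD]] _] := HP.
have [u_dx u_cont _ u_glue] := u_C01; have [v_dx v_cont _ v_glue] := v_C01.
have sigma_ge0 k y p : 0 <= y <= a k -> 0 <= sigma k y p.
  move=> yk; have /andP[+ _] := sigma_bnd k y p yk.
  by apply: le_trans; rewrite mulr_ge0 ?powR_ge0 ?(ltW nu1_gt0).
have w_cont k : {within `[0, T] `*` `[0, a k],
    continuous (fun y : R * R => v k y.1 y.2 - u k y.1 y.2)}.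
  exact: within_continuousB (v_cont k) (u_cont k).
rewrite leNgt; apply/negP; rewrite -subr_gt0 => w_gt0.
have [s /andP[s0 sT] ws_gt0] : exists2 s, 0 <= s < T & 0 < v i s x - u i s x.
  move: tT; rewrite le_eqVlt => /predU1P[tT|tT]; last by exists t => //; rewrite t0.
  move: w_gt0; rewrite tT => w_gt0.
  exact: (gt0_before_end _ _ _ _ (fun y => v i y.1 y.2 - u i y.1 y.2)
    T_gt0 (w_cont i) xi w_gt0).
have [K K_ge0 bndK] := C12b_uniform_bound _ _ _ _ _ _ u_C12b v_C12b.
have [C C_gt0 /(_ K K_ge0)[L L_ge0 incr]] :=
  P_derivatives_increments _ _ _ _ _ _ m2 sigma_C1 H_C1 PD.
(* With this choice the coefficient [lam - C] of [v - u] in the final estimate is 1. *)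
pose lam := C + 1.
pose M := expR (- lam * s) * (v i s x - u i s x).
have M_gt0 : 0 < M by rewrite mulr_gt0 ?expR_gt0.
have [A A_ge0 aA] : exists2 A, 0 <= A & forall k, a k <= A.
  exists (\sum_k a k) => [|k]; first by apply: sumr_ge0 => k _; exact: ltW.
  by rewrite (bigD1 k)//= lerDl sumr_ge0// => j _; exact: ltW.
have LK_ge0 : 0 <= L * (K + 1) by rewrite mulr_ge0// addr_ge0.
(* Two losses must together stay below [M]: at most [delta * A] from the tilt, and
   [delta * (L * (K + 1))] from the equation. The extra 1 makes the inequality strict and the
   denominator positive. *)
pose delta := M / (A + L * (K + 1) + 1).
have delta_gt0 : 0 < delta by rewrite divr_gt0//; lra.
have deltaM : delta * (A + L * (K + 1)) < M.
  have : delta * (A + L * (K + 1) + 1) = M by rewrite divfK// gt_eqF//; lra.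
  lra.
pose z k r y := expR (- lam * r) * (v k r y - u k r y) + delta * y.
have z_cont k : {within `[0, s] `*` `[0, a k],
    continuous (fun y : R * R => z k y.1 y.2)}.
  have sub : `[0, s] `*` `[0, a k] `<=` `[0, T] `*` `[0, a k].
    move=> y [/= y1 y2]; split => //=; move: y1; rewrite !in_itv /=.
    by move=> /andP[-> /le_trans->]//; exact: ltW.
  have /subspace_continuousP wc := continuous_subspaceW sub (w_cont k).
  apply/subspace_continuousP => y Dy; apply: cvgD; first apply: cvgM.
  - apply: cvg_within_filter.
    apply: (continuous_comp (f := fun y : R * R => - lam * y.1) (g := expR)).
      by apply: cvgM; [exact: cvg_cst|exact: cvg_fst].
    exact: continuous_expR.
  - exact: wc.
  - by apply: cvg_within_filter; apply: cvgM; [exact: cvg_cst|exact: cvg_snd].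
have [j [r [y [/andP[r0 rs] /andP[y0 yj] zmax]]]] :=
  continuous_family_max _ _ _ _ _ i s0 (fun k => ltW (a_gt0 k)) z_cont.
have xi0 : 0 <= x by case/andP: xi.
have Mz : M <= expR (- lam * r) * (v j r y - u j r y) + delta * y.
  apply: le_trans (zmax i s x _ xi); last by rewrite s0 lexx.
  by rewrite /z lerDl mulr_ge0// ltW.
have e_gt0 : 0 < expR (- lam * r) by exact: expR_gt0.
have w_low : M - delta * A <= expR (- lam * r) * (v j r y - u j r y).
  have : delta * y <= delta * A by rewrite ler_wpM2l ?(le_trans yj)// ltW.
  lra.
(* Positivity of [v - u] at the maximum point then excludes the initial time and the outer end of
   the edge, where [v <= u]. *)
have w_pos : 0 < v j r y - u j r y.
  have : 0 <= delta * (L * (K + 1)) by rewrite mulr_ge0// ltW.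
  by rewrite -(pmulr_rgt0 _ e_gt0); lra.
have r_gt0 : 0 < r.
  rewrite lt_neqAle r0 andbT; apply/eqP => r_eq0.
  have := uv_init j y; rewrite in_itv /= y0 yj => /(_ isT).
  by move: w_pos; rewrite -r_eq0 subr_gt0 ltNge => /negP.
have rT : r < T by exact: le_lt_trans sT.
have rTm : r \in `[0, T] by rewrite in_itv /= r0 ltW.
have rTo : r \in `]0, T[ by rewrite in_itv /= r_gt0.
have y_lt : y < a j.
  rewrite lt_neqAle yj andbT; apply/eqP => y_eq.
  by have := uv_bdry j r rTm; move: w_pos; rewrite y_eq subr_gt0 ltNge => /negP.
(* This is the slope of the tilt once the discount factor at the fixed time [r] is divided out. *)
pose d := delta * expR (lam * r).
have d_gt0 : 0 < d by rewrite mulr_gt0 ?expR_gt0.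
have ed : expR (- lam * r) * d = delta.
  by rewrite mulrCA -expRD mulNr addNr expR0 mulr1.
have xmax k y' : 0 <= y' <= a k ->
    v k r y' - u k r y' + d * y' <= v j r y - u j r y + d * y.
  move=> y'k; have := zmax k r y' _ y'k; rewrite r0 rs => /(_ isT).
  by rewrite /z -ed -!mulrA -!mulrDr ler_pM2l.
have [y_eq0|y_gt0] : y = 0 \/ 0 < y.
  by have [|] := ltP 0 y; [right|left; apply/eqP; rewrite eq_le y0 andbT].
  have [_ uF] := u_super; have [_ vF] := v_sub.
  (* Continuity across the vertex makes [v - u] there independent of the edge, so a maximum at
     [y = 0] is a maximum along every edge at once. *)
  have glue k : v k r 0 - u k r 0 = v j r 0 - u j r 0.
    by rewrite (v_glue k j)// (u_glue k j).
  have F_lt : F (vertex_value v r, vertex_dx a v r)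
      < F (vertex_value u r, vertex_dx a u r).
    apply: P_vertex_lt => // k; rewrite !mxE.
      by rewrite -subr_gt0 glue; move: w_pos; rewrite y_eq0.
    have zk : (0 : R) \in `[0, a k] by rewrite in_itv /= lexx ltW.
    have : dx a v k r 0 + d <= dx a u k r 0.
      apply: derive_in_le_left_end => //; [exact: v_dx|exact: u_dx|].
      by move=> y' /xmax; rewrite y_eq0 mulr0 addr0 glue.
    lra.
  by move: F_lt; rewrite ltNge (le_trans (uF r rTo))// vF.
have rTo' : 0 < r < T by rewrite r_gt0.
have yjo : 0 < y < a j by rewrite y_gt0.
have yjm : y \in `]0, a j[ by rewrite in_itv.
have yjc : 0 <= y <= a j by rewrite y0.
have [/(_ r y rTo yjm)[_ v_dxx v_dt] _ _ _ _] := v_C12b j.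
have [/(_ r y rTo yjm)[_ u_dxx u_dt] _ _ _ _] := u_C12b j.
have [] := interior_max_derivatives _ (fun y' => v j r y' - u j r y' + d * y')
    (fun y' => dx a v j r y' - dx a u j r y' + d) _ _ _ yjo.
- move=> y' y'j.
  have := is_deriveD (is_deriveB (is_derive_dx _ _ _ _ _ j r y' v_C12b rTo' y'j)
    (is_derive_dx _ _ _ _ _ j r y' u_C12b rTo' y'j)) (is_deriveZ d (is_derive_id y' 1)).
  by move=> /is_derive_eq; apply; rewrite /GRing.scale /= mulr1.
- exact: derivableD (derivableB v_dxx u_dxx) (@derivable_cst _ _ _ d _ _).
- by move=> y' /andP[? ?]; apply: xmax; rewrite !ltW.
move=> dx_eq dxx_le.
(* Along a fixed [y] the tilt is constant in time and cancels from the comparison. *)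
have dt_ge : lam * (v j r y - u j r y) <= dt v j r y - dt u j r y.
  have := discounted_left_max_derive1 _ (fun r' => v j r' y - u j r' y) lam _ _
    r_gt0 (derivableB v_dt u_dt).
  rewrite derive1E (deriveB v_dt u_dt) -!derive1E; apply => r' /andP[r'0 r'r].
  have := zmax j r' y _ yjc; rewrite /z lerD2r; apply.
  by rewrite !ltW// (lt_le_trans r'r).
have {}dxx_le : dxx a v j r y <= dxx a u j r y.
  rewrite -subr_le0; apply: le_trans dxx_le.
  rewrite derive1E (deriveD (derivableB v_dxx u_dxx) (@derivable_cst _ _ _ d _ _)).
  by rewrite (deriveB v_dxx u_dxx) derive_cst addr0 -!derive1E.
have [uP _] := u_super; have [vP _] := v_sub.
have [bu1 bu2 bu3 bv] := bndK j r y rTo' yjo.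
have dlt : dx a v j r y < dx a u j r y by lra.
have [sL HL Hmono] := incr j y yjc _ _ dlt bu2 bv.
have dE : dx a u j r y - dx a v j r y = d by lra.
rewrite dE in sL HL.
have vu : u j r y < v j r y by rewrite -subr_gt0.
(* The increment of [H] is split through [H j y (u j r y) (dx a v j r y)]: first the value changes
   at the slope of [v], then the slope changes at the value of [u]. *)
have := interior_max_bound _ _ _ _ _ _ _ _ _ _ _ lam C K L d
  (sigma_ge0 _ _ _ yjc) L_ge0 (ltW d_gt0) (vP j r y rTo yjm) (uP j r y rTo yjm)
  dt_ge dxx_le bu3 sL (Hmono _ _ vu) (HL _ bu1).
(* What remains is [v - u <= L * (K + 1) * d]. Multiplying by the discount factor replaces [d] by
   [delta], which contradicts [w_low] and [deltaM]. *)
rewrite (_ : lam - C = 1) ?mul1r; last by rewrite /lam; lra.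
rewrite -(ler_pM2l e_gt0) mulrCA ed; lra.
Qed.
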